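(* There exists a constant $c>0$ such that for all sufficiently large $n$ there is a partial function $f$ on $\{0,1\}^n$ that is minimally non-extendable and whose domain satisfies $|\mathrm{D}(f)| \ge 2^{cn}$ (i.e. $|\mathrm{D}(f)| = 2^{\Omega(n)}$).
   Context: A partial function $f$ on $\{0,1\}^n$ is a real-valued function defined on a subset $\mathrm{D}(f)\subseteq\{0,1\}^n$. A function $g:\{0,1\}^n\to\mathbb{R}$ is submodular if $g(x+\mathbf{e}_i)-g(x) \ge g(y+\mathbf{e}_i)-g(y)$ for all $i$ and all $x\le y$ (coordinatewise) with $x_i=y_i=0$, where $\mathbf{e}_i$ is the $i$-th standard basis vector. A partial function $f$ is extendable if there is a submodular $g:\{0,1\}^n\to\mathbb{R}$ agreeing with $f$ on $\mathrm{D}(f)$. For $\mathcal{A}\subseteq\{0,1\}^n$, $f|_{\mathcal{A}}$ is the partial function agreeing with $f$ on $\mathcal{A}\cap \mathrm{D}(f)$ and undefined elsewhere. $f$ is minimally non-extendable if $f$ is not extendable but $f|_{\mathcal{A}}$ is extendable for every proper subset $\mathcal{A}\subsetneq \mathrm{D}(f)$. *)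

(* Defs.v *)
From mathcomp Require Import all_boot.
From Stdlib Require Import Reals.
Set Implicit Arguments. Unset Strict Implicit. Unset Printing Implicit Defensive.

Definition cube (n : nat) := {ffun 'I_n -> bool}.

Definition cube_le n (x y : cube n) : Prop := forall i, x i -> y i.

(* x + e_i, used only when x_i = 0: set coordinate i to 1 *)
Definition add_e n (x : cube n) (i : 'I_n) : cube n :=
  [ffun j => if j == i then true else x j].

Definition submodular n (g : cube n -> R) : Prop :=
  forall (i : 'I_n) (x y : cube n), cube_le x y -> x i = false -> y i = false ->
    (g (add_e x i) - g x >= g (add_e y i) - g y)%R.

(* A partial function: a domain D together with values f on it
   (values of f outside D are irrelevant). *)
Record pfun (n : nat) := PFun { pdom : {set cube n}; pval : cube n -> R }.

Definition extendable n (f : pfun n) : Prop :=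
  exists g : cube n -> R, submodular g /\ forall x, x \in pdom f -> g x = pval f x.

Definition restrict n (f : pfun n) (A : {set cube n}) : pfun n :=
  PFun (A :&: pdom f) (pval f).

Definition min_non_extendable n (f : pfun n) : Prop :=
  ~ extendable f /\
  forall A : {set cube n}, A \proper pdom f -> extendable (restrict f A).

(* Main.v *)
(** Group the coordinates into pairs ("blocks").  Starting from the point whose
    blocks all equal 01, the squares
      (s 00 01..01), (s 01 01..01), (s 10 01..01), (s 11 01..01),
    with every block of s in {00, 11}, form a binary tree: the submodular
    inequality of a square bounds its 01-corner, given its 10-corner, from below
    by its 00- and 11-corners, which are the 01-corners of squares one level
    deeper.  Summing over the tree cancels all inner 01-corners and leaves an
    inequality between the root, the 10-corners and the 2^m leaves.
    There is a submodular function [base] for which exactly these squares are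
    tight, all other squares having slack at least 1.  Lowering 4 * base by 1 at
    the root violates the summed inequality; but once a single support point p is
    forgotten, the dip can be pushed down the path from the root to p and absorbed
    there, and the slack of the other squares pays for the perturbation. *)

Require Import Defs.
From mathcomp Require Import zify all_boot.
From Stdlib Require Import Reals Lia Lra.
Set Implicit Arguments. Unset Strict Implicit. Unset Printing Implicit Defensive.

(* Block r consists of the coordinates 2r ([o = false]) and 2r+1 ([o = true]),
   so "01" in the header means bit false = 1, bit true = 0; a coordinate
   outside the cube reads 0.  For odd n the last block is incomplete: it can
   still be 01, but no square lies in it. *)
Definition bit n (x : cube n) (r : nat) (o : bool) : bool :=
  oapp x false (insub (r.*2 + o)).

Lemma bit_ord n (x : cube n) (i : 'I_n) : bit x i./2 (odd i) = x i.
Proof. by rewrite /bit addnC odd_double_half valK. Qed.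

Lemma bit_add_e n (x : cube n) (i : 'I_n) r o :
  bit (add_e x i) r o = ((r == i./2) && (o == odd i)) || bit x r o.
Proof.
have -> : (r == i./2) && (o == odd i) = (r.*2 + o == i).
  by apply/andP/eqP => [[/eqP -> /eqP ->]|]; lia.
rewrite /bit; case: insubP => [j lt_j <-|] /=.
  by rewrite ffunE -val_eqE; case: (_ == _).
by case: eqP => // ->; rewrite ltn_ord.
Qed.

Lemma bit_inj n (x y : cube n) :
  (forall r o, r < uphalf n -> bit x r o = bit y r o) -> x = y.
Proof.
move=> E; apply/ffunP => i; rewrite -!bit_ord; apply: E.
by have := ltn_ord i; lia.
Qed.

(** * Submodularity from two-dimensional squares *)

Lemma add_eC n (x : cube n) (i j : 'I_n) : add_e (add_e x i) j = add_e (add_e x j) i.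
Proof. by apply/ffunP => k; rewrite !ffunE; case: eqP; case: eqP. Qed.

(** Telescoping: [x] is raised to [y] one coordinate at a time, by induction on the number of
    coordinates where they differ. *)
Lemma submodular_local n (g : cube n -> R) :
  (forall (x : cube n) i j, i != j -> x i = false -> x j = false ->
     (g x + g (add_e (add_e x i) j) <= g (add_e x i) + g (add_e x j))%R) ->
  submodular g.
Proof.
move=> loc i x y; have [k] := ubnP #|[set j | y j && ~~ x j]|.
elim: k => // k IH in x y *; rewrite ltnS => le_k le_xy xi yi.
have [E|[j]] := set_0Vmem [set j | y j && ~~ x j].
  have -> : y = x; last exact: Rle_refl.
  apply/ffunP => j; have := in_set0 j; rewrite -E inE.
  by have := le_xy j; case: (x j) (y j) => [] [] // ->.
rewrite inE => /andP [yj xj].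
have ne : j != i by apply: contraTneq yj => ->; rewrite yi.
have H := loc x j i ne (negbTE xj) xi.
suff : (g (add_e (add_e x j) i) - g (add_e x j) >= g (add_e y i) - g y)%R by lra.
apply: IH => //; last 2 first.
- by move=> l; rewrite ffunE; case: eqP => [-> //|_]; apply: le_xy.
- by rewrite ffunE eq_sym (negbTE ne).
apply: leq_trans le_k; apply: proper_card; apply/properP; split.
  by apply/subsetP => l; rewrite !inE ffunE; case: eqP => //; rewrite andbF.
by exists j; rewrite !inE ?ffunE ?eqxx ?yj ?xj.
Qed.

(** * Second differences of the coupling terms *)

Definition diff2 n (g : cube n -> Z) (x : cube n) (i j : 'I_n) : Z :=
  (g x + g (add_e (add_e x i) j) - g (add_e x i) - g (add_e x j))%Z.

Lemma diff2C n (g : cube n -> Z) x (i j : 'I_n) : diff2 g x i j = diff2 g x j i.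
Proof. by rewrite /diff2 add_eC; lia. Qed.

Definition balanced n (x : cube n) r := bit x r false == bit x r true.
Definition mid n (x : cube n) r := bit x r false && ~~ bit x r true.

(* Couples an earlier block (b, a) with a later block (d, c).  The first product
   makes squares in the later block strict unless b = a; the second one does so
   for squares in the earlier block unless (d, c) = (1, 0), and outweighs the
   wrong-sign contribution of the first; the third one makes every square across
   the two blocks strict. *)
Definition phi (b a d c : bool) : Z :=
  let z := Z.b2z in
  (- (z c * z d * (z a + z b - 2 * z a * z b))
   - 3 * (z a * z b * (z c + 1 - z d)) - 5 * ((z a + z b) * (z c + z d)))%Z.

(** A computable quantifier, so that a claim about booleans becomes one closed evaluation. *)
Definition all_bool (p : bool -> bool) := p true && p false.

Lemma all_boolP p : all_bool p -> forall b, p b.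
Proof. by case/andP => ? ? []. Qed.

(** A finite check. [ir] and [it] tell whether coordinate i lies in the earlier or the later block,
    [oi] is its parity, and likewise for j; the premises encode i != j and x_i = x_j = 0. *)
Lemma phi_diff2 (b a d c ir it oi jr jt oj : bool) :
  let strict := [|| ir && jt, it && jr, ir && jr && ~~ (d && ~~ c)
                 | it && jt && (b != a)] in
  let D := (phi b a d c
    + phi (jr && ~~ oj || (ir && ~~ oi || b)) (jr && oj || (ir && oi || a))
          (jt && ~~ oj || (it && ~~ oi || d)) (jt && oj || (it && oi || c))
    - phi (ir && ~~ oi || b) (ir && oi || a) (it && ~~ oi || d) (it && oi || c)
    - phi (jr && ~~ oj || b) (jr && oj || a) (jt && ~~ oj || d) (jt && oj || c))%Z in
  [&& ~~ (ir && it), ~~ (jr && jt), ~~ [&& ir || it, ir == jr, it == jt & oi == oj],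
      ~~ (ir && if oi then a else b), ~~ (it && if oi then c else d),
      ~~ (jr && if oj then a else b) & ~~ (jt && if oj then c else d)] ==>
  if strict then (D <=? -1)%Z else (D =? 0)%Z.
Proof.
cbv zeta.
move: oj; refine (all_boolP _); move: jt; refine (all_boolP _).
move: jr; refine (all_boolP _); move: oi; refine (all_boolP _).
move: it; refine (all_boolP _); move: ir; refine (all_boolP _).
move: c; refine (all_boolP _); move: d; refine (all_boolP _).
move: a; refine (all_boolP _); move: b; refine (all_boolP _).
by vm_compute.
Qed.

Definition term n (p : nat * nat) (x : cube n) : Z :=
  phi (bit x p.1 false) (bit x p.1 true) (bit x p.2 false) (bit x p.2 true).

Definition strict n (x : cube n) (i j : 'I_n) (p : nat * nat) : bool :=
  [|| (p.1 == i./2) && (p.2 == j./2), (p.2 == i./2) && (p.1 == j./2),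
      (p.1 == i./2) && (p.1 == j./2) && ~~ mid x p.2
    | (p.2 == i./2) && (p.2 == j./2) && ~~ balanced x p.1].

Lemma term_diff2 n (x : cube n) (i j : 'I_n) p :
  p.1 < p.2 -> i != j -> x i = false -> x j = false ->
  if strict x i j p then (diff2 (term p) x i j <= -1)%Z
  else diff2 (term p) x i j = 0%Z.
Proof.
case: p => r t /= lt_rt ne xi xj.
have := phi_diff2 (bit x r false) (bit x r true) (bit x t false) (bit x t true)
  (r == i./2) (t == i./2) (odd i) (r == j./2) (t == j./2) (odd j).
have Hi : forall q, ~~ ((q == i./2) && (if odd i then bit x q true else bit x q false)).
  move=> q; case: eqP => //= ->; move: xi; rewrite -bit_ord; by case: odd => ->.
have Hj : forall q, ~~ ((q == j./2) && (if odd j then bit x q true else bit x q false)).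
  move=> q; case: eqP => //= ->; move: xj; rewrite -bit_ord; by case: odd => ->.
rewrite !Hi !Hj /=.
have -> : ~~ ((r == i./2) && (t == i./2)) by lia.
have -> : ~~ ((r == j./2) && (t == j./2)) by lia.
have -> : ~~ [&& (r == i./2) || (t == i./2), (r == i./2) == (r == j./2),
   (t == i./2) == (t == j./2) & odd i == odd j].
  move: ne; rewrite -val_eqE /=; lia.
rewrite /= /strict /diff2 /term /mid /balanced /= !bit_add_e /= !(eqbF_neg, eq_sym false, eq_sym true, eqb_id).
case: ifP; lia.
Qed.

Lemma sum_diff2 n (s : seq (nat * nat)) (x : cube n) (i j : 'I_n) :
  (forall p, p \in s -> p.1 < p.2) -> i != j -> x i = false -> x j = false ->
  let g y := \big[Z.add/0%Z]_(p <- s) term p y in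
  if has (strict x i j) s then (diff2 g x i j <= -1)%Z else diff2 g x i j = 0%Z.
Proof.
move=> lt_s ne xi xj; elim: s lt_s => [|p s IH] lt_s /=.
  by rewrite /diff2 !big_nil.
have /IH : forall q, q \in s -> q.1 < q.2 by move=> q qs; apply: lt_s; rewrite inE qs orbT.
have := term_diff2 (lt_s p (mem_head _ _)) ne xi xj.
rewrite /diff2 !big_cons.
case: (strict x i j p) (has _ s) => [] [] /=; lia.
Qed.

(** * The tree, the tight squares of [base], and perturbations *)

Definition spine n t (x : cube n) :=
  [forall r : 'I_(uphalf n), if r < t then balanced x r else (r == t :> nat) || mid x r].

(** [spine t] leaves block t free and so describes a whole tree square; [node t] and [coface t] pick
    its 01- and 10-corners. Level 0 is the root, level [n./2] consists of the leaves. *)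
Definition node n t (x : cube n) :=
  [forall r : 'I_(uphalf n), if r < t then balanced x r else mid x r].

Definition coface n t (x : cube n) := [&& spine t x, ~~ bit x t false & bit x t true].

Lemma spineP n t (x : cube n) :
  reflect (forall r, r < uphalf n ->
             if r < t then balanced x r else (r == t) || mid x r) (spine t x).
Proof.
by apply: (iffP forallP) => [H r lt_r|H r]; [apply: (H (Ordinal lt_r)) | apply: H].
Qed.

Lemma nodeP n t (x : cube n) :
  reflect (forall r, r < uphalf n -> if r < t then balanced x r else mid x r) (node t x).
Proof.
by apply: (iffP forallP) => [H r lt_r|H r]; [apply: (H (Ordinal lt_r)) | apply: H].
Qed.

Definition block_pairs M := [seq (r, t) | t <- iota 0 M, r <- iota 0 t].

Lemma mem_block_pairs M r t : ((r, t) \in block_pairs M) = (r < t < M).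
Proof.
apply/allpairsPdep/idP => [[u [v []]]|/andP [lt_rt lt_t]].
  by rewrite !mem_iota => Hu Hv [-> ->]; lia.
by exists t, r; rewrite !mem_iota.
Qed.

Definition base n (x : cube n) : Z :=
  \big[Z.add/0%Z]_(p <- block_pairs (uphalf n)) term p x.

(** A square across two blocks is strict for that very pair; for a square inside one block, any
    block violating [spine] forms a strict pair with it. *)
Lemma has_strict n (x : cube n) (i j : 'I_n) :
  has (strict x i j) (block_pairs (uphalf n)) =
  ~~ ((i./2 == j./2) && spine i./2 x).
Proof.
have [li lj] := (ltn_ord i, ltn_ord j).
apply/hasP/idP => [[[r t]]|].
  rewrite mem_block_pairs /strict /= => lt_rt.
  apply: contraL => /andP [/eqP <- /spineP sp].
  have [Hr Ht] := (sp r ltac:(lia), sp t ltac:(lia)).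
  move: Hr Ht; case: ifP; case: ifP; lia.
rewrite negb_and; case: eqP => [E /forallPn [r]|ne _]; last first.
  exists (minn i./2 j./2, maxn i./2 j./2); first by rewrite mem_block_pairs; lia.
  rewrite /strict /=; lia.
have lt_r := ltn_ord r; case: (ltnP r i./2) => [lt_ri nbal|le_r].
  exists (nat_of_ord r, i./2); first by rewrite mem_block_pairs; lia.
  by rewrite /strict /= -E nbal !eqxx !orbT.
rewrite negb_or => /andP [ne nmid].
exists (i./2, nat_of_ord r); first by rewrite mem_block_pairs; lia.
by rewrite /strict /= -E nmid !eqxx !orbT.
Qed.

Lemma base_diff2 n (x : cube n) (i j : 'I_n) :
  i != j -> x i = false -> x j = false ->
  if (i./2 == j./2) && spine i./2 x then diff2 (@base n) x i j = 0%Z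
  else (diff2 (@base n) x i j <= -1)%Z.
Proof.
move=> ne xi xj.
have lt_s p : p \in block_pairs (uphalf n) -> p.1 < p.2.
  by case: p => r t; rewrite mem_block_pairs => /andP [].
by have /= := sum_diff2 lt_s ne xi xj; rewrite has_strict if_neg.
Qed.

(** The factor 4 turns slack 1 into slack 4, the most that four values in [-1, 1] can use up; only
    the tight squares impose a condition on [w]. *)
Lemma submodular_perturb n (w : cube n -> Z) :
  (forall x, -1 <= w x <= 1)%Z ->
  (forall (z : cube n) (i j : 'I_n), z i = false -> z j = false ->
     ~~ odd i -> odd j -> i./2 = j./2 -> spine i./2 z -> (diff2 w z i j <= 0)%Z) ->
  submodular (fun x => IZR (4 * base x + w x)).
Proof.
move=> bw sq; apply: submodular_local => x i j ne xi xj.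
rewrite -!plus_IZR; apply: IZR_le.
have := base_diff2 ne xi xj.
case: ifP => [/andP [/eqP E sp]|_].
  suff : (diff2 w x i j <= 0)%Z by rewrite /diff2; lia.
  case Oi: (odd i).
    rewrite diff2C; apply: sq => //; rewrite -?E //.
    move: ne; rewrite -val_eqE /=; lia.
  apply: sq => //; rewrite ?Oi //; move: ne; rewrite -val_eqE /=; lia.
have := bw x; have := bw (add_e x i); have := bw (add_e x j).
have := bw (add_e (add_e x i) j); rewrite /diff2; lia.
Qed.

(** * Levels of the tree, paths and the support *)

Lemma lt_half_uphalf t n : t < n./2 -> t < uphalf n.
Proof. lia. Qed.

Lemma node_spine n t (x : cube n) :
  t < n./2 -> (node t x) = spine t x && mid x t.
Proof.
move=> lt_t; apply/nodeP/andP => [H|[/spineP H mt] r lt_r].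
  split; last by have := H t (lt_half_uphalf lt_t); rewrite ltnn.
  by apply/spineP => r /H; case: ifP => // _ ->; rewrite orbT.
by have := H r lt_r; case: ifP => // _ /orP [/eqP ->|].
Qed.

Lemma node_succ_spine n t (x : cube n) :
  t < n./2 -> (node t.+1 x) = spine t x && balanced x t.
Proof.
move=> lt_t; apply/nodeP/andP => [H|[/spineP H mt] r lt_r].
  split; last by have := H t (lt_half_uphalf lt_t); rewrite ltnSn.
  apply/spineP => r /H; rewrite ltnS.
  by case: (ltngtP r t) => //= ->.
have := H r lt_r; rewrite ltnS; case: (ltngtP r t) => [||->] //=.
Qed.

Lemma node_uniq n s t (x : cube n) :
  s <= n./2 -> t <= n./2 -> node s x -> node t x -> s = t.
Proof.
wlog lt_st : s t / s < t.
  by move=> H ls lt ns nt; case: (ltngtP s t) => // l; [|symmetry]; apply: H.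
move=> _ le_t; have lt_sm := leq_trans lt_st le_t; move=> /nodeP /(_ s (lt_half_uphalf lt_sm)) + /nodeP /(_ s (lt_half_uphalf lt_sm)).
by rewrite ltnn lt_st /mid /balanced; do 2 case: bit.
Qed.

(** Block t of a 10-corner is neither balanced nor [mid]. *)
Lemma node_coface n s t (x : cube n) :
  s <= n./2 -> t < n./2 -> node s x -> coface t x = false.
Proof.
move=> le_s lt_t /nodeP /(_ t (lt_half_uphalf lt_t)); rewrite /coface /mid /balanced.
by case: ifP; do 2 case: bit; rewrite /= ?andbF.
Qed.

Definition agree n t (x p : cube n) :=
  [forall r : 'I_(uphalf n), (r < t) ==> [forall o, bit x r o == bit p r o]].

Lemma agreeP n t (x p : cube n) :
  reflect (forall r o, r < uphalf n -> r < t -> bit x r o = bit p r o) (agree t x p).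
Proof.
apply: (iffP forallP) => [H r o lt_r lt_rt|H r].
  by move: (H (Ordinal lt_r)); rewrite /= lt_rt => /forallP /(_ o) /eqP.
by apply/implyP => lt_rt; apply/forallP => o; apply/eqP/H.
Qed.

Lemma agree_succ n t (x y p : cube n) :
  t < uphalf n -> (forall r o, r != t -> bit x r o = bit y r o) ->
  agree t.+1 x p = agree t y p && [forall o, bit x t o == bit p t o].
Proof.
move=> lt_t E; apply/agreeP/andP => [H|[/agreeP H /forallP Ht] r o lt_r].
  split; last by apply/forallP => o; rewrite H.
  by apply/agreeP => r o lt_r lt_rt; rewrite -E ?H //; lia.
rewrite ltnS; case: (ltngtP r t) => // [lt_rt _|-> _]; last exact/eqP.
by rewrite E ?H //; lia.
Qed.

(** For [p] in the support these are the nodes from the root towards [p]. For a 10-corner [p] they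
    end at the 01-corner of its square, as the unbalanced block stops any deeper agreement. *)
Definition on_path n (p x : cube n) :=
  [exists t : 'I_(n./2).+1, node t x && agree t x p].

Lemma on_path_node n t (p x : cube n) :
  t <= n./2 -> node t x -> on_path p x = agree t x p.
Proof.
move=> le_t nt; apply/existsP/idP => [[s /andP [ns]]|ag].
  have les : s <= n./2 by rewrite -ltnS.
  by rewrite (node_uniq les le_t ns nt).
have lt_t : t < n./2.+1 by [].
by exists (Ordinal lt_t); rewrite nt.
Qed.

Lemma on_pathN n (p x : cube n) :
  (forall t, t <= n./2 -> node t x = false) -> on_path p x = false.
Proof.
by move=> H; apply/existsP => [[t /andP []]]; rewrite H // -ltnS.
Qed.

Definition support n : {set cube n} :=
  [set x | [|| node 0 x, node n./2 x | [exists t : 'I_(n./2), coface t x]]].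

Lemma supportP n (x : cube n) :
  reflect [\/ node 0 x, node n./2 x | exists2 t, t < n./2 & coface t x] (x \in support n).
Proof.
rewrite inE; apply: (iffP or3P) => [] [-> | -> | ].
- by constructor 1.
- by constructor 2.
- by case/existsP => t ?; constructor 3; exists t.
- by constructor 1.
- by constructor 2.
- by case=> t lt_t ?; constructor 3; apply/existsP; exists (Ordinal lt_t).
Qed.

Definition root_dip n (x : cube n) : Z := (- Z.b2z (node 0 x))%Z.

(* At a non-leaf p, which is the root or a 10-corner, the dip must cancel
   instead of being passed to a leaf. *)
Definition path_dip n (p x : cube n) : Z :=
  (Z.b2z ((x == p) && ~~ node n./2 p) - Z.b2z (on_path p x))%Z.

Lemma node0_inj n (x y : cube n) : node 0 x -> node 0 y -> x = y.
Proof.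
move=> /nodeP Hx /nodeP Hy; apply: bit_inj => r o lt_r.
have := Hx r lt_r; have := Hy r lt_r; rewrite /mid /=.
by case: o; do 4 case: bit.
Qed.

(** The path meets the support only in the root and possibly in [p]. *)
Lemma path_dip_off n (p x : cube n) :
  0 < n./2 -> p \in support n -> x \in support n -> x != p ->
  path_dip p x = root_dip x.
Proof.
move=> m_gt0 /supportP Sp /supportP Sx ne.
rewrite /path_dip /root_dip (negbTE ne) /=.
suff -> : on_path p x = node 0 x by [].
case: Sx => [n0|nm|[t lt_t cf]].
- by rewrite (on_path_node _ (leq0n _) n0) // n0; apply/agreeP.
- have -> : node 0 x = false.
    by apply: contraTF m_gt0 => n0; rewrite (node_uniq (leq0n _) (leqnn _) n0 nm) ltnn.
  (* A leaf on the path shares all complete blocks with [p], so [p] is a leaf too; an incomplete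
     last block is 01 in both, whence [x = p]. *)
  rewrite (on_path_node _ (leqnn _) nm) //; apply: contraNF ne => /agreeP ag.
  have bal r : r < n./2 -> balanced p r.
    move=> lt_r; move/nodeP/(_ r (lt_half_uphalf lt_r)): (nm); rewrite lt_r /balanced.
    by rewrite !ag //; lia.
  have nmp : node n./2 p.
    case: Sp => // [/nodeP /(_ 0 (lt_half_uphalf m_gt0))|[t lt_t]].
      by have := bal 0 m_gt0; rewrite /mid /balanced; do 2 case: bit.
    by case/and3P => _; have := bal t lt_t; rewrite /balanced; do 2 case: bit.
  apply/eqP/bit_inj => r o lt_r; case: (ltnP r n./2) => [lt_rm|ge_rm]; first exact: ag.
  move/nodeP/(_ r lt_r): nm; move/nodeP/(_ r lt_r): nmp.
  by rewrite ltnNge ge_rm /mid /=; case: o; do 4 case: bit.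
- rewrite on_pathN => [|s le_s].
    by symmetry; apply: contraTF cf => n0; rewrite (node_coface (leq0n _) lt_t n0).
  by apply: contraTF cf => ns; rewrite (node_coface le_s lt_t ns).
Qed.

(** * Tree squares and the dip along a path *)

Lemma spine_square n t (z : cube n) (i j : 'I_n) :
  z i = false -> z j = false -> ~~ odd i -> odd j -> i./2 = t -> j./2 = t ->
  spine t z ->
  [/\ node t (add_e z i), coface t (add_e z j), node t.+1 z &
      node t.+1 (add_e (add_e z i) j)].
Proof.
rewrite -!bit_ord => zi zj /negbTE oi oj ei ej sp.
have lt_t : t < n./2 by have := ltn_ord j; rewrite -ej; lia.
rewrite oi oj ei ej in zi zj.
(* [spine t] does not read block t, so all corners of the square share it. *)
have spE (x : cube n) : (forall r o, r != t -> bit x r o = bit z r o) -> spine t x.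
  move=> E; apply/spineP => r lt_r; have /spineP/(_ r lt_r) := sp.
  by case: (eqVneq r t) => [->|ne]; rewrite ?ltnn // /balanced /mid !E.
rewrite node_spine // !node_succ_spine // /coface /mid /balanced !bit_add_e !zi !zj.
rewrite ei ej oi oj eqxx /= sp !spE // => r o /negbTE ne; rewrite ?bit_add_e ?ei ?ej ne //.
Qed.

(** Clearing coordinate 2t gives the 00-corner; [t < n./2] puts both 2t and 2t+1 inside the cube. *)
Lemma node_bottom n t (x : cube n) :
  t < n./2 -> node t x ->
  exists z : cube n, exists i j : 'I_n,
    [/\ z i = false, z j = false, ~~ odd i, odd j &
        [/\ i./2 = t, j./2 = t, spine t z & add_e z i = x]].
Proof.
move=> lt_t; rewrite node_spine // => /andP [sp /andP [x0 /negbTE x1]].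
have lt_i : t.*2 < n by lia.
have lt_j : t.*2.+1 < n by lia.
pose i := Ordinal lt_i; pose j := Ordinal lt_j.
have [hi hj] : i./2 = t /\ j./2 = t by rewrite /=; lia.
have [oi oj] : odd i = false /\ odd j by rewrite /= odd_double.
pose z : cube n := [ffun l => (l != i) && x l].
have Xz : add_e z i = x.
  apply/ffunP => l; rewrite !ffunE; case: eqP => // -> /=.
  by rewrite -bit_ord hi oi x0.
exists z, i, j; split; rewrite ?oi //; first by rewrite ffunE eqxx.
  by rewrite ffunE -(bit_ord x) hj oj x1 andbF.
split => //; apply/spineP => r lt_r; have /spineP/(_ r lt_r) := sp.
rewrite -Xz /balanced /mid !bit_add_e hi.
by case: (eqVneq r t) => //= ->; rewrite ltnn.
Qed.

Lemma path_dip_square n (p z : cube n) (i j : 'I_n) :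
  p \in support n -> z i = false -> z j = false -> ~~ odd i -> odd j ->
  i./2 = j./2 -> spine i./2 z -> (diff2 (path_dip p) z i j <= 0)%Z.
Proof.
move=> /supportP Sp zi zj oi oj eij; set t := i./2 => sp.
have lt_t : t < n./2 by have := ltn_ord j; rewrite /t; lia.
have [nX nC nz nZ] := spine_square zi zj oi oj (erefl t) (esym eij) sp.
(* Below the root, a node belongs to the support only as a leaf, so the correction at [p] vanishes
   on both children. *)
have child y : node t.+1 y -> path_dip p y = (- Z.b2z (agree t.+1 y p))%Z.
  move=> ny; rewrite /path_dip (on_path_node _ lt_t ny).
  suff -> : (y == p) && ~~ node n./2 p = false by [].
  apply/negbTE/andP => [[/eqP E /negP nl]]; rewrite E in ny.
  case: Sp => // [n0|[s lt_s]].
    by have := node_uniq (leq0n _) lt_t n0 ny.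
  by rewrite (node_coface lt_t lt_s ny).
have offC : on_path p (add_e z j) = false.
  apply: on_pathN => s le_s; apply: contraTF nC => ns.
  by rewrite (node_coface le_s lt_t ns).
have lt_tM := lt_half_uphalf lt_t.
rewrite /diff2 (child z nz) (child _ nZ) /path_dip offC (on_path_node _ (ltnW lt_t) nX).
rewrite !(@agree_succ n t _ (add_e z i)) //; last first.
- by move=> r o ne; rewrite bit_add_e (negbTE ne).
- by move=> r o ne; rewrite !bit_add_e -eij (negbTE ne).
case agp: (agree t (add_e z i) p) => /=; last by do 2 case: (_ && _).
have nlX : node n./2 (add_e z i) = false.
  by apply: contraTF (lt_t) => nl; rewrite (node_uniq (ltnW lt_t) (leqnn _) nX nl) ltnn.
have nlC : node n./2 (add_e z j) = false.
  by apply: contraTF nC => nl; rewrite (node_coface (leqnn _) lt_t nl).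
set oz := [forall o, bit z t o == _]; set oZ := [forall o, bit _ t o == _].
(* The path through the 01-corner either ends there, with [p] the root, or leads to [p] at the
   10-corner, or continues to the 00- or 11-child. *)
suff : [|| add_e z i == p, add_e z j == p, oz | oZ].
  case: eqP => [<-|_]; first by rewrite nlX /=; move: oz oZ (_ == _) => [] [] [].
  case: eqP => [<-|_]; first by rewrite nlC /=; move: oz oZ => [] [].
  by move: oz oZ => [] [].
have zt o : bit z t o = false.
  by case: o; [move: zj | move: zi]; rewrite -bit_ord ?oj ?(negbTE oi) -?eij.
have balX r : r < t -> balanced p r.
  move=> lt_r; have lt_rM := ltn_trans lt_r lt_tM.
  move/nodeP/(_ r lt_rM): nX; rewrite lt_r /balanced.
  by rewrite !(agreeP _ _ _ agp).
have bal_p : balanced p t -> oz || oZ.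
  move=> bp; case b0: (bit p t false); apply/orP; [right|left]; apply/forallP => o.
    rewrite !bit_add_e -eij eqxx oj (negbTE oi) zt orbF.
    by move: bp b0; rewrite /balanced; case: o; do 2 case: bit.
  by rewrite zt; move: bp b0; rewrite /balanced; case: o; do 2 case: bit.
case: Sp => [n0|nl|[s lt_s cf]].
- suff t0 : t = 0 by rewrite t0 in nX; rewrite (node0_inj nX n0) eqxx.
  case: (posnP t) => // t_gt0; move/nodeP/(_ 0 (ltn_trans t_gt0 lt_tM)): n0.
  by have := balX 0 t_gt0; rewrite /balanced /mid; do 2 case: bit.
- rewrite bal_p ?orbT //.
  by move/nodeP/(_ t lt_tM): nl; rewrite lt_t.
case/and3P: (cf) => /spineP sp_p p0 p1.
case: (ltngtP s t) => [lt_st|gt_st|est].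
- by move: (balX s lt_st) p0 p1; rewrite /balanced; do 2 case: bit.
- rewrite bal_p ?orbT //.
  by have := sp_p t lt_tM; rewrite gt_st.
rewrite est in sp_p p0 p1.
suff -> : add_e z j = p by rewrite eqxx orbT.
apply: bit_inj => r o lt_r; case: (ltngtP r t) => [lt_rt|gt_rt|->].
- by rewrite -(agreeP _ _ _ agp) // !bit_add_e -eij (ltn_eqF lt_rt).
- have [/spineP/(_ r lt_r) + _ _] := and3P nC; have := sp_p r lt_r.
  rewrite ltnNge (ltnW gt_rt) (gtn_eqF gt_rt) /mid /=.
  by case: o; do 4 case: bit.
rewrite bit_add_e -eij eqxx oj zt orbF.
by case: o p0 p1; do 2 case: bit.
Qed.

(** * The root and the number of leaves *)

Definition root n : cube n := [ffun i : 'I_n => ~~ odd i].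

Lemma node0_root n : node 0 (root n).
Proof.
apply/nodeP => r lt_r; rewrite /mid /bit /=.
case: insubP => [i _ vi|]; last by lia.
rewrite /= ffunE vi addn0 odd_double /=.
by case: insubP => //= k _ vk; rewrite ffunE vk addn1 /= odd_double.
Qed.

(** The leaves suffice: each complete block is freely 00 or 11. *)
Lemma card_support n : expn 2 n./2 <= #|support n|.
Proof.
pose leaf (A : {set 'I_(n./2)}) : cube n :=
  (* The default [~~ odd i] applies only to the last coordinate for odd n, and makes the incomplete
     block 01. *)
  [ffun i : 'I_n => oapp (fun k => k \in A) (~~ odd i) (insub i./2)].
have bit_leaf A r o : r < uphalf n -> bit (leaf A) r o =
    oapp (fun k => k \in A) (~~ o && (r.*2 < n)) (insub r).
  move=> lt_r; rewrite /bit; case: (insubP _ (r.*2 + o)) => [i _ vi|].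
    rewrite /= ffunE vi; have -> : (r.*2 + o)./2 = r by lia.
    by congr oapp; have := ltn_ord i; rewrite vi; case: o {vi}; lia.
  case: insubP => /= [k|]; first by have := ltn_ord k; case: o; lia.
  by case: o; lia.
have -> : expn 2 n./2 = #|leaf @: [set: {set 'I_(n./2)}]|.
  rewrite card_imset -?powersetT ?card_powerset ?cardsT ?card_ord //.
  move=> A B E; apply/setP => k.
  have := bit_leaf A k false; have := bit_leaf B k false.
  by rewrite E valK /= => <- => [<-|]; have := ltn_ord k; lia.
apply/subset_leq_card/subsetP => _ /imsetP [A _ ->].
apply/supportP; constructor 2; apply/nodeP => r lt_r.
rewrite /balanced /mid !bit_leaf //; case: insubP => [k -> _ /=|]; first exact: eqxx.
by move=> /negbTE -> /=; lia.
Qed.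

(** * The minimally non-extendable function *)

Definition witness n : pfun n :=
  PFun (support n) (fun x => IZR (4 * base x + root_dip x)).

Lemma witness_restrict n (A : {set cube n}) :
  0 < n./2 -> A \proper pdom (witness n) -> extendable (restrict (witness n) A).
Proof.
move=> m_gt0 /properP [_ [p Sp nAp]].
exists (fun x => IZR (4 * base x + path_dip p x)); split.
  apply: submodular_perturb => [x|z i j]; last exact: path_dip_square.
  by rewrite /path_dip; case: (_ && _) (on_path p x) => [] [].
move=> x; rewrite inE => /andP [Ax Sx] /=.
have ne : x != p by apply/eqP => E; rewrite -E Ax in nAp.
by rewrite path_dip_off.
Qed.

Lemma witness_not_extendable n : 0 < n./2 -> ~ extendable (witness n).
Proof.
move=> m_gt0 [g [sub_g eq_g]].
pose e (x : cube n) := (g x - IZR (4 * base x))%R.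
have eS x : x \in support n -> e x = IZR (root_dip x).
  by move=> Sx; rewrite /e eq_g //= plus_IZR; lra.
have root_dip0 t (x : cube n) : 0 < t <= n./2 -> node t x -> root_dip x = 0%Z.
  move=> /andP [t_gt0 le_t] nt; rewrite /root_dip.
  suff -> : node 0 x = false by [].
  by apply: contraTF t_gt0 => n0; rewrite (node_uniq (leq0n _) le_t n0 nt) ltnn.
(* Induction from the leaves upwards, [k] being the height. On a tree square [base] cancels, so [e]
   inherits the submodular inequality; it vanishes at leaves and 10-corners, while the root requires
   -1. *)
have e_ge0 k : forall t x, t + k = n./2 -> node t x -> (0 <= e x)%R.
  elim: k => [|k IH] t x E nt.
    rewrite addn0 in E; rewrite eS; last by apply/supportP; constructor 2; rewrite -E.
    by rewrite (root_dip0 t x _ nt); [lra | rewrite E m_gt0 leqnn].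
  have lt_t : t < n./2 by lia.
  have [z [i [j [zi zj oi oj [ei ej sz Xz]]]]] := node_bottom lt_t nt.
  have [_ nC nz nZ] := spine_square zi zj oi oj ei ej sz.
  have := IH t.+1 _ _ nz; have := IH t.+1 _ _ nZ; rewrite addSnnS => /(_ E) eZ /(_ E) ez.
  have eC : e (add_e z j) = 0%R.
    rewrite eS; last by apply/supportP; constructor 3; exists t.
    rewrite /root_dip; suff -> : node 0 (add_e z j) = false by [].
    by apply: contraTF nC => n0; rewrite (node_coface (leq0n _) lt_t n0).
  have ne : j != i by apply: contraTneq oj => ->.
  have base0 : diff2 (@base n) z i j = 0%Z.
    by have := base_diff2 _ zi zj; rewrite ei ej eqxx sz /=; apply; rewrite eq_sym.
  have le_zZ : cube_le z (add_e z j) by move=> l; rewrite ffunE => ->; case: ifP.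
  have Zi : add_e z j i = false by rewrite ffunE eq_sym (negbTE ne).
  have := sub_g i z (add_e z j) le_zZ zi Zi.
  move: eZ ez eC; rewrite -Xz [add_e (add_e z j) i]add_eC /e !mult_IZR.
  have := f_equal IZR base0; rewrite /diff2 !minus_IZR plus_IZR; lra.
have := e_ge0 _ 0 (root n) (add0n _) (node0_root n).
rewrite eS; last by apply/supportP; constructor 1; apply: node0_root.
by rewrite /root_dip node0_root /=; lra.
Qed.

Theorem theorem2 :
  exists c : R, (0 < c)%R /\
  exists N : nat, forall n : nat, (N <= n)%N ->
    exists f : pfun n, min_non_extendable f /\
      (Rpower 2 (c * INR n) <= INR #|pdom f|)%R.
Proof.
(* From n = 2 on there is a complete block and [n <= 4 * n./2], so the 2^(n./2) leaves number at
   least 2^(n/4). *)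
exists (/ 4)%R; split; first by lra.
exists 2 => n le_2n; have m_gt0 : 0 < n./2 by lia.
exists (witness n); split.
  by split; [apply: witness_not_extendable | move=> A; apply: witness_restrict].
apply: (Rle_trans _ (INR (expn 2 n./2))); last by apply/le_INR/leP/card_support.
have -> : INR (expn 2 n./2) = Rpower 2 (INR n./2).
  rewrite Rpower_pow; last by lra.
  by elim: n./2 => //= k IH; rewrite expnS mult_INR IH.
apply: Rle_Rpower; first by lra.
have : (INR n <= INR (4 * n./2))%R by apply/le_INR/leP; lia.
rewrite mult_INR /=; lra.
Qed.
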